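(* Let $n\ge 2$, and let $d_1,\ldots,d_n\ge 2$ all be even. Then the bipartite generalized hypercube $G=C(d_1,\ldots,d_n)$ is edge-bipancyclic.
   Context: All graphs are finite, undirected and simple. $C_m$ denotes the cycle on $m$ vertices and $K_2$ the complete graph on two vertices. The Cartesian product $A\mathbin{\square}B$ has vertex set $V(A)\times V(B)$, with $(a,b)$ and $(a',b')$ adjacent iff either $a=a'$ and $bb'\in E(B)$, or $b=b'$ and $aa'\in E(A)$. Generalized hypercube: for $d_1,\ldots,d_n\ge 2$, $C(d_1,\ldots,d_n)=F_1\mathbin{\square}\cdots\mathbin{\square}F_n$, where $F_i=K_2$ if $d_i=2$ and $F_i=C_{d_i}$ if $d_i\ge 3$. (It is bipartite exactly when all $d_i$ are even.) A bipartite graph of order $m$ is edge-bipancyclic if every edge lies on a cycle of every even length from $4$ to $m$ (inclusive), the length of a cycle being its number of edges. *)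

(* Defs.v *)
From mathcomp Require Import all_boot.

Set Implicit Arguments.
Unset Strict Implicit.
Unset Printing Implicit Defensive.

Record sgraph := SGraph {
  vertex :> finType;
  edge : rel vertex;
  edge_sym : symmetric edge;
  edge_irrefl : irreflexive edge
}.

Section CompleteGraph.
Variable m : nat.

Definition complete_rel : rel 'I_m := fun i j => i != j.

Fact complete_sym : symmetric complete_rel.
Proof. by move=> i j; rewrite /complete_rel eq_sym. Qed.

Fact complete_irrefl : irreflexive complete_rel.
Proof. by move=> i; rewrite /complete_rel eqxx. Qed.

Definition complete_graph := SGraph complete_sym complete_irrefl.
End CompleteGraph.

Section CycleGraph.
Variable m : nat.

(* The conjunct i != j only matters for m = 1, where i.+1 %% m = i. *)
Definition cycle_rel : rel 'I_m := fun i j =>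
  (i != j) && ((i.+1 %% m == j) || (j.+1 %% m == i)).

Fact cycle_sym : symmetric cycle_rel.
Proof. by move=> i j; rewrite /cycle_rel eq_sym orbC. Qed.

Fact cycle_irrefl : irreflexive cycle_rel.
Proof. by move=> i; rewrite /cycle_rel eqxx. Qed.

Definition cycle_graph := SGraph cycle_sym cycle_irrefl.
End CycleGraph.

Section CartesianProduct.
Variables A B : sgraph.

Definition cprod_rel : rel (A * B) := fun u v =>
  ((u.1 == v.1) && edge u.2 v.2) || ((u.2 == v.2) && edge u.1 v.1).

Fact cprod_sym : symmetric cprod_rel.
Proof.
move=> u v; rewrite /cprod_rel (eq_sym u.1) (eq_sym u.2).
by rewrite (edge_sym u.1) (edge_sym u.2).
Qed.

Fact cprod_irrefl : irreflexive cprod_rel.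
Proof. by move=> u; rewrite /cprod_rel !edge_irrefl !andbF. Qed.

Definition cartesian_product := SGraph cprod_sym cprod_irrefl.
End CartesianProduct.

Definition hypercube_factor (d : nat) : sgraph :=
  if d == 2 then complete_graph 2 else cycle_graph d.

(* C(d_1, ..., d_n), associated to the right; the empty product is K_1. *)
Fixpoint gen_hypercube (ds : seq nat) : sgraph :=
  match ds with
  | [::] => complete_graph 1
  | [:: d] => hypercube_factor d
  | d :: ds' => cartesian_product (hypercube_factor d) (gen_hypercube ds')
  end.

Definition bipartite (G : sgraph) : Prop :=
  exists A : {set G}, forall x y : G, edge x y -> (x \in A) != (y \in A).

(* Since a cycle has at least 3 vertices, its number of edges is size c. *)
Definition is_cycle (G : sgraph) (c : seq G) : Prop :=
  2 < size c /\ ucycle (@edge G) c.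

Definition edge_on_cycle (G : sgraph) (x y : G) (c : seq G) : bool :=
  ((x \in c) && (next c x == y)) || ((y \in c) && (next c y == x)).

Definition edge_bipancyclic (G : sgraph) : Prop :=
  bipartite G /\
  forall x y : G, edge x y ->
  forall l : nat, ~~ odd l -> 4 <= l <= #|G| ->
  exists c : seq G, [/\ is_cycle c, size c = l & edge_on_cycle x y c].

(* Main.v *)
Require Import Defs.
From mathcomp Require Import all_boot.
From mathcomp Require Import zify.

Set Implicit Arguments.
Unset Strict Implicit.
Unset Printing Implicit Defensive.

(** The proof reduces the generalized hypercube to a grid.  Suppose that every
    edge of H is the first edge of a Hamiltonian path of H, and likewise for
    K, and that K has an even number of vertices.  An edge of the product of
    H and K has the form (x, y) - (x', y) or (x, y) - (x, y').  Choose a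
    Hamiltonian path of H starting with x, x' and one of K starting with
    y, y'; their product is a spanning grid of H [] K with corner (x, y), and
    the given edge is one of the two grid edges at this corner.  Any cycle of
    the grid through a corner uses both edges there, so it is enough to find,
    in a grid with an even number of columns, cycles of all even lengths
    through the corner.

    These cycles are combs ([comb_path]).  Group the columns in consecutive
    pairs.  A pair of columns is traversed by a tooth: down one column and up
    the other.  The comb enters each pair of columns along the first row,
    goes on to the pairs on its right, returns along the second row, and then
    runs through the rest of the current pair.  With j full teeth and a last
    one of height h, where 1 <= h <= a and a is the number of rows, the comb
    has 2 (a j + h) vertices, and every even number up to the order of the
    grid is of this form.

    A Hamiltonian cycle through each edge gives a Hamiltonian path starting
    with that edge, so the hypothesis passes from the factors to the product,
    and an induction on the number of factors applies
    ([even_traceable_cartesian_product]).  It starts from K_2 and from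
    single even cycles; a cycle with more than four vertices is not
    edge-bipancyclic but does satisfy the hypothesis, which is why the
    induction carries traceability instead of edge-bipancyclicity. *)

(** * Cycles through a given edge *)

(** The two neighbours of a vertex on a cycle play symmetric roles: reading
    the cycle backwards from x exchanges them. *)
Lemma ucycle_reflect (G : sgraph) (x z : G) (p : seq G) :
  ucycle (@edge G) (x :: rcons p z) -> ucycle (@edge G) (x :: z :: rev p).
Proof.
have rotE : rot 1 (x :: z :: rev p) = rev (x :: rcons p z).
  by rewrite rev_cons rev_rcons rot1_cons.
case/andP=> cyc uq; apply/andP.
rewrite -(rot_cycle 1) -(rot_uniq 1) rotE rev_uniq rev_cycle; split=> //.
by rewrite (@eq_cycle _ _ (@edge G)) // => u v; rewrite edge_sym.
Qed.

Lemma ucycle_from (G : sgraph) (c : seq G) (x : G) :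
  ucycle (@edge G) c -> 1 < size c -> x \in c ->
  exists p, ucycle (@edge G) (x :: next c x :: p)
            /\ size (x :: next c x :: p) = size c.
Proof.
case/andP=> cyc uq sz xc; case: (rot_to xc) => i c' def_c.
have := next_rot i uq x; rewrite def_c.
have sz' : size (x :: c') = size c by rewrite -def_c size_rot.
case: c' def_c sz' => [|y p] def_c sz'; first by rewrite -sz' in sz.
rewrite /= eqxx => <-; exists p; split=> //.
by apply/andP; rewrite -def_c rot_cycle rot_uniq.
Qed.

(** Paths are required to start with the ordered pair x, y, so each edge is
    the initial one of two Hamiltonian paths, one for each orientation. *)
Definition edge_traceable (G : sgraph) : Prop :=
  forall x y : G, edge x y ->
  exists p, [/\ path (@edge G) x (y :: p), uniq (x :: y :: p)
              & size (x :: y :: p) = #|G|].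

Lemma ucycle_traces (G : sgraph) (x y : G) (p : seq G) :
  ucycle (@edge G) (x :: y :: p) ->
  path (@edge G) x (y :: p) /\ uniq (x :: y :: p).
Proof.
case/andP=> cyc uq; split=> //; move: cyc.
by rewrite -[cycle _ _]/(path _ x (rcons (y :: p) x)) rcons_path => /andP[].
Qed.

(** * Combs in a product of two paths *)

#[local] Arguments edge : simpl never.

Section Comb.
Variables H K : sgraph.
Local Notation G := (cartesian_product H K).
Local Notation eG := (@edge G).

Lemma edge_column (y : K) (x x' : H) :
  edge x x' -> eG (x, y) (x', y).
Proof. by move=> e; apply/orP; right; rewrite /= eqxx. Qed.

Lemma edge_row (x : H) (y y' : K) :
  edge y y' -> eG (x, y) (x, y').
Proof. by move=> e; apply/orP; left; rewrite /= eqxx. Qed.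

Lemma path_column (y : K) (x : H) (s : seq H) :
  path (@edge H) x s -> path eG (x, y) [seq (u, y) | u <- s].
Proof.
elim: s x => [|u s IH] x //= /andP[e ps]; apply/andP; split; last exact: IH.
exact: edge_column.
Qed.

(** Down the column y' along q, then back up the column y. *)
Definition tooth (y y' : K) (q : seq H) : seq G :=
  [seq (u, y') | u <- q] ++ rev [seq (u, y) | u <- q].

Lemma size_tooth y y' q : size (tooth y y' q) = (size q).*2.
Proof. by rewrite size_cat size_rev !size_map addnn. Qed.

Lemma mem_tooth y y' q (u : G) :
  (u \in tooth y y' q) = (u.1 \in q) && ((u.2 == y) || (u.2 == y')).
Proof.
case: u => a b; rewrite mem_cat mem_rev /=.
apply/orP/andP => [[] /mapP[v vq [-> ->]]|[aq]].
- by rewrite eqxx orbT.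
- by rewrite eqxx.
- by case/orP=> /eqP->; [right|left]; apply: map_f.
Qed.

Lemma uniq_tooth y y' q : y != y' -> uniq q -> uniq (tooth y y' q).
Proof.
move=> ny uq; rewrite cat_uniq rev_uniq !map_inj_uniq ?uq; try by move=> ? ? [].
rewrite andbT; apply/hasPn => u; rewrite mem_rev => /mapP[v _ ->].
by apply/mapP=> -[w _ [_ /eqP]]; rewrite (negPf ny).
Qed.

(** A tooth is exposed with its last vertex split off, because the closing
    edge of the comb leaves from there. *)
Lemma path_tooth (y y' : K) (z : G) (x : H) (q : seq H) :
  edge y y' -> path (@edge H) x q -> eG z (x, y') ->
  exists r, tooth y y' (x :: q) = rcons r (x, y) /\ path eG z (rcons r (x, y)).
Proof.
move=> ey pq ez; exists ([seq (u, y') | u <- x :: q] ++ rev [seq (u, y) | u <- q]).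
have -> : rcons ([seq (u, y') | u <- x :: q] ++ rev [seq (u, y) | u <- q]) (x, y)
   = tooth y y' (x :: q) by rewrite /tooth /= rev_cons !rcons_cat -!cats1 -?catA.
split=> //; rewrite /tooth cat_path /= ez path_column //=.
rewrite (last_map (fun u => (u, y'))).
case/lastP: q pq => [|q w] pq; first by rewrite /= edge_sym edge_row.
rewrite last_rcons map_rcons -rcons_cons rev_rcons [path _ _ _]/=.
rewrite edge_sym edge_row //=.
have := path_column y pq; rewrite map_rcons.
move=> pc; have := rev_path eG (x, y) (rcons [seq (u, y) | u <- q] (w, y)).
rewrite last_rcons belast_rcons => ->.
by rewrite (@eq_path _ _ eG) // => u v; rewrite edge_sym.
Qed.

(** The induction removes two columns at a time.  Either a single tooth of
    height k suffices, or the tooth of the first two columns is full and the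
    comb of the remaining ones is inserted between the two top vertices of
    the column y'.  The control of the columns met by r keeps the inserted
    comb disjoint from the tooth; the last conclusion records that the comb
    leaves the corner along the first row, so that once it is closed by the
    edge from (x', y) to (x, y) it uses both edges at the corner. *)
Lemma comb_path (x x' : H) (s : seq H) (c : nat) (y y' : K) (t : seq K) (k : nat) :
  path (@edge H) x (x' :: s) -> uniq (x :: x' :: s) ->
  path (@edge K) y (y' :: t) -> uniq (y :: y' :: t) ->
  (size t).+2 = c.*2 -> 0 < k <= c * (size s).+2 ->
  exists r, [/\ path eG (x, y) (rcons r (x', y)),
                uniq ((x, y) :: rcons r (x', y)),
                (size r).+2 = k.*2,
                {subset r <= [pred u : G | u.2 \in y :: y' :: t]}
              & 1 < k -> exists r', r = (x, y') :: r'].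
Proof.
move=> ps us; elim: c y y' t k => [|c IH] y y' t k pt ut // st kb.
have [exx' pxs] := andP ps; have [eyy' pyt] := andP pt.
have ny : y != y' by move: ut; rewrite /= inE negb_or => /andP[/andP[]].
have [nx us'] : x \notin x' :: s /\ uniq (x' :: s) by apply/andP.
have [k_le|k_gt] := leqP k (size s).+2.
  (* One tooth: for k = 1 it degenerates to a single edge. *)
  case: k kb k_le => [|[|k]] // kb k_le.
    exists [::]; split=> //=; first by rewrite andbT edge_column.
    rewrite andbT inE xpair_eqE eqxx andbT.
    by apply: contra nx => /eqP->; rewrite mem_head.
  have pq : path (@edge H) x' (take k s) by apply: take_path.
  have sub : {subset x' :: take k s <= x' :: s}.
    by move=> u; rewrite !inE => /predU1P[->|/mem_take ->]; rewrite ?eqxx ?orbT.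
  have uq : uniq (x' :: take k s).
    by apply: subseq_uniq us'; rewrite /= eqxx take_subseq.
  have [r [def_r pr]] := path_tooth eyy' pq (edge_column y' exx').
  exists ((x, y') :: r); split.
  - by rewrite rcons_cons [path _ _ _]/= edge_row.
  - rewrite rcons_cons -def_r 2!cons_uniq inE !mem_tooth uniq_tooth //.
    rewrite xpair_eqE eqxx (negPf ny) /=.
    by rewrite !(contraNF (@sub _) nx).
  - have := size_tooth y y' (x' :: take k s).
    rewrite def_r size_rcons [size (_ :: _)]/= size_takel // => -[sr].
    by rewrite [size (_ :: _)]/= sr !doubleS.
  - move=> u; rewrite inE => /predU1P[->|ur]; first by rewrite !inE eqxx orbT.
    have: u \in tooth y y' (x' :: take k s) by rewrite def_r mem_rcons inE ur orbT.
    by rewrite mem_tooth !inE orbA => /andP[_ ->].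
  - by exists r.
case: t pt ut st pyt => [|z [|z' t]] pt ut st pyt.
- have c0 : c = 0 by case: c st {IH kb}.
  by move: kb k_gt; rewrite c0 mul1n (leqNgt k) => /andP[_ /negPf->].
- by case: c st {IH kb} => // c; rewrite /= doubleS.
move: ut; rewrite !(cons_uniq y) (cons_uniq y') => /and3P[yt y't ut'].
have [eyz pzt] := andP pyt.
(* A full tooth takes 2 (size s + 2) vertices; the other columns get the rest. *)
have [||r [pr ur sr sub_r _]] := IH z z' t (k - (size s).+2) pzt ut'.
- by move: st; rewrite doubleS /= => -[].
- by rewrite subn_gt0 k_gt leq_subLR -mulSn; case/andP: kb.
have [r2 [def_r2 pr2]] :=
  path_tooth (z := (x', z)) eyy' pxs
    (eq_ind_r is_true (edge_row x' eyz) (edge_sym _ _)).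
have sub_zr (u : G) : u \in (x, z) :: rcons r (x', z) -> u.2 \in z :: z' :: t.
  rewrite inE mem_rcons inE => /or3P[/eqP->|/eqP->|/sub_r//]; exact: mem_head.
have yt' : y \notin z :: z' :: t by apply: contra yt; rewrite (in_cons y') orbC => ->.
have notin_zr w (a : H) : w \notin z :: z' :: t ->
    (a, w) \notin (x, z) :: rcons r (x', z).
  by apply: contra => /sub_zr.
exists ((x, y') :: ((x, z) :: rcons r (x', z)) ++ r2); split; last by eexists.
- rewrite rcons_cons rcons_cat [path _ _ _]/= edge_row // edge_row //=.
  by rewrite cat_path pr last_rcons.
- rewrite rcons_cons rcons_cat -def_r2 2!cons_uniq.
  rewrite inE mem_cat mem_tooth mem_cat mem_tooth (negPf nx) andFb !orbF.
  rewrite xpair_eqE eqxx (negPf ny) (negPf (notin_zr y x yt')).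
  rewrite (negPf (notin_zr y' x y't)) cat_uniq ur uniq_tooth // andbT.
  apply/hasPn => -[a w]; rewrite mem_tooth /= => /andP[_ /orP[]/eqP->];
    exact: notin_zr.
- have := size_tooth y y' (x' :: s); rewrite def_r2 size_rcons => sr2.
  by rewrite /= size_cat /= size_rcons; move: sr sr2 k_gt => /=; clear; lia.
- move=> u; rewrite inE mem_cat => /or3P[/eqP->|/sub_zr|ur2].
  + by rewrite !inE eqxx orbT.
  + by rewrite !inE => ->; rewrite !orbT.
  have: u \in tooth y y' (x' :: s) by rewrite def_r2 mem_rcons inE ur2 orbT.
  by rewrite mem_tooth !inE orbA => /andP[_ ->].
Qed.

Lemma comb_cycle (x x' : H) (y y' : K) (l : nat) :
  edge_traceable H -> edge_traceable K -> ~~ odd #|K| ->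
  edge x x' -> edge y y' -> ~~ odd l -> 4 <= l <= #|G| ->
  exists r, ucycle eG ((x, y) :: rcons ((x, y') :: r) (x', y))
            /\ (size r).+3 = l.
Proof.
move=> trH trK oddK ex ey oddl /andP[l4 lG].
have [s [ps us ss]] := trH _ _ ex; have [t [pt ut st]] := trK _ _ ey.
have oK := even_halfK oddK; have ol := even_halfK oddl.
have cardG : #|G| = #|H| * #|K| by rewrite card_prod.
have [||r [pr ur sr _ [|r' def_r]]] :=
    @comb_path x x' s #|K|./2 y y' t l./2 ps us pt ut.
- by rewrite oK -st.
- move: ss oK ol cardG lG l4 => /= ->; clear; nia.
- by move: ol l4; clear; lia.
exists r'; rewrite -def_r; split; last by move: sr; rewrite def_r /= ol.
apply/andP; split=> //.
by rewrite /= rcons_path pr last_rcons edge_sym edge_column.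
Qed.

(** Both kinds of edges are corner edges of a comb; the existence of
    neighbours provides the second direction of the grid.  A comb starts with
    its edge inside a copy of K and closes with its edge inside a copy of H,
    so the latter kind needs the reflected cycle. *)
Lemma ucycles_cartesian_product (u v : G) (l : nat) :
  edge_traceable H -> edge_traceable K -> ~~ odd #|K| ->
  (forall x : H, exists x', edge x x') -> (forall y : K, exists y', edge y y') ->
  edge u v -> ~~ odd l -> 4 <= l <= #|G| ->
  exists p, ucycle eG (u :: v :: p) /\ size (u :: v :: p) = l.
Proof.
move=> trH trK oddK nH nK; case: u v => [x y] [x' y'] euv oddl lb.
case/orP: euv => /= /andP[/eqP E e]; subst.
  have [w ew] := nH x'.
  have [r [cyc sz]] := comb_cycle trH trK oddK ew e oddl lb.
  by exists (rcons r (w, y)); split; rewrite //= size_rcons.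
have [w ew] := nK y'.
have [r [cyc sz]] := comb_cycle trH trK oddK e ew oddl lb.
exists (rev ((x, w) :: r)); split; first exact: ucycle_reflect.
by rewrite /= size_rev.
Qed.

Lemma bipartite_cartesian_product : bipartite H -> bipartite K -> bipartite G.
Proof.
move=> [A bA] [B bB]; exists [set u : G | (u.1 \in A) (+) (u.2 \in B)].
case=> x y [x' y']; rewrite !inE /= => /orP[] /= /andP[/eqP -> e].
  by have := bB _ _ e; do 3!case: (_ \in _).
by have := bA _ _ e; do 3!case: (_ \in _).
Qed.

End Comb.

(** * Passing from the factors to the product *)

(** Neighbours are required because traceability is vacuous at an isolated
    vertex, from which no direction of the grid could be chosen. *)
Record even_traceable (G : sgraph) : Prop := EvenTraceable {
  et_bipartite : bipartite G;
  et_even : ~~ odd #|G|;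
  et_neighbour : forall x : G, exists y, edge x y;
  et_traceable : edge_traceable G
}.

Lemma even_traceable_cartesian_product (H K : sgraph) :
  even_traceable H -> even_traceable K ->
  edge_bipancyclic (cartesian_product H K)
  /\ even_traceable (cartesian_product H K).
Proof.
move=> [bH oH nH tH] [bK oK nK tK]; set G := cartesian_product H K.
have bG : bipartite G by apply: bipartite_cartesian_product.
have cardG : #|G| = #|H| * #|K| by rewrite card_prod.
have cycles (u v : G) l : edge u v -> ~~ odd l -> 4 <= l <= #|G| ->
  exists p, ucycle (@edge G) (u :: v :: p) /\ size (u :: v :: p) = l.
  exact: ucycles_cartesian_product.
have oG : ~~ odd #|G| by rewrite cardG oddM negb_and oH.
split; first split=> // u v e l ol /andP[l4 lG].
  have [|p [cyc sz]] := cycles u v l e ol; first by rewrite l4.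
  exists (u :: v :: p); split; rewrite // /is_cycle ?sz; first by split=> //; lia.
  by rewrite /edge_on_cycle mem_head /= eqxx eqxx.
split=> //.
  by case=> x y; have [x' e] := nH x; exists (x', y); apply: edge_column.
move=> u v e; have [|p [cyc sz]] := cycles u v #|G| e oG.
  rewrite leqnn andbT cardG.
  have H0 : 0 < #|H| by apply/card_gt0P; exists u.1.
  have K0 : 0 < #|K| by apply/card_gt0P; exists u.2.
  by nia.
by have [pp up] := ucycle_traces cyc; exists p.
Qed.

(** * Single factors *)

Lemma even_traceable_K2 : even_traceable (complete_graph 2).
Proof.
split.
- exists [set ord0 : 'I_2] => x y; rewrite !inE.
  by case: x y => [[|[|x]] ?] // [[|[|y]] ?].
- by rewrite card_ord.
- by case=> [[|[|x]] ?] //; [exists ord_max|exists ord0].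
- move=> x y e; exists [::]; split; rewrite /= ?card_ord ?andbT ?inE //.
Qed.

Lemma next_enum_ord (m : nat) (x : 'I_m) : next (enum 'I_m) x = ordS x.
Proof.
apply: val_inj; rewrite -(next_map val_inj) ?enum_uniq // val_enum_ord /=.
case: m x => [|k] x; first by case: x.
have index_x : index (x : nat) (iota 0 k.+1) = x.
  by rewrite -{1}[x : nat](nth_iota 0 0 (ltn_ord x)) index_uniq ?iota_uniq ?size_iota.
rewrite next_nth mem_iota ltn_ord index_x [LHS]/=.
have := ltn_ord x; rewrite ltnS leq_eqVlt => /predU1P[->|x_lt].
  by rewrite nth_default ?size_iota // modnn.
by rewrite nth_iota // modn_small.
Qed.

Lemma edge_ordS (m : nat) (x : cycle_graph m) : 1 < m -> edge x (ordS x).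
Proof.
move=> m_gt1; apply/andP; split; last by rewrite /= eqxx.
apply/eqP => /(congr1 val)/esym/eqP.
rewrite /= -[X in _ == X](modn_small (ltn_ord x)) -addn1.
by rewrite -[X in _ == X %[mod _]]addn0 eqn_modDl mod0n modn_small.
Qed.

Lemma ucycle_cycle_graph (m : nat) :
  1 < m -> ucycle (@edge (cycle_graph m)) (enum 'I_m).
Proof.
move=> m_gt1; apply/andP; split; last exact: enum_uniq.
apply: cycle_from_next; first exact: enum_uniq.
by move=> x _; rewrite next_enum_ord edge_ordS.
Qed.

(** An edge of the cycle is followed all the way round; the edges that go
    against the enumeration are handled by reflection. *)
Lemma even_traceable_cycle_graph (m : nat) :
  1 < m -> ~~ odd m -> even_traceable (cycle_graph m).
Proof.
move=> m_gt1 om; set C := cycle_graph m; split.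
- exists [set i : 'I_m | odd i] => x y; rewrite !inE => /andP[_].
  by case/orP=> /eqP<-; rewrite odd_mod ?(negPf om) //=; case: (odd _).
- by rewrite card_ord.
- by move=> x; exists (ordS x); apply: edge_ordS.
have oriented (x y : C) : x.+1 %% m == y ->
  exists p, ucycle (@edge C) (x :: y :: p) /\ size (x :: y :: p) = m.
  move=> xy; have <- : next (enum 'I_m) x = y.
    by rewrite next_enum_ord; apply/val_inj/eqP.
  have := ucycle_from (x := x) (ucycle_cycle_graph m_gt1).
  by rewrite size_enum_ord mem_enum; apply.
move=> x y /andP[_ exy].
suff [p [cyc sz]] : exists p,
    ucycle (@edge C) (x :: y :: p) /\ size (x :: y :: p) = m.
  by have [? ?] := ucycle_traces cyc; exists p; rewrite card_ord.
case/orP: exy => exy; first exact: oriented.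
have [p [cyc sz]] := oriented y x exy.
have : ucycle (@edge C) (x :: rcons p y).
  rewrite -rcons_cons -(rot1_cons y); apply/andP.
  by rewrite rot_cycle rot_uniq; apply/andP.
by move/ucycle_reflect; exists (rev p); rewrite /= size_rev.
Qed.

Lemma even_traceable_hypercube_factor (d : nat) :
  1 < d -> ~~ odd d -> even_traceable (hypercube_factor d).
Proof.
rewrite /hypercube_factor; case: eqP => _ d1 od; first exact: even_traceable_K2.
exact: even_traceable_cycle_graph.
Qed.

Lemma even_traceable_gen_hypercube (d : nat) (ds : seq nat) :
  all [pred e | (1 < e) && ~~ odd e] (d :: ds) ->
  even_traceable (gen_hypercube (d :: ds)).
Proof.
elim: ds d => [|d' ds IH] d /= /andP[/andP[d1 od]].
  by move=> _; apply: even_traceable_hypercube_factor.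
move/IH=> tr.
have := even_traceable_hypercube_factor d1 od.
by move/even_traceable_cartesian_product/(_ tr) => [].
Qed.

Theorem corollary4p2 (n : nat) (d : n.-tuple nat)
    (hn : 2 <= n)
    (hd : forall i : 'I_n, 2 <= tnth d i)
    (heven : forall i : 'I_n, ~~ odd (tnth d i)) :
  edge_bipancyclic (gen_hypercube d).
Proof.
have all_d : all [pred e | (1 < e) && ~~ odd e] d.
  by apply/all_tnthP => i /=; rewrite hd heven.
have sz_d : 1 < size d by rewrite size_tuple.
case: (tval d) all_d sz_d => [|d1 [|d2 ds]] // /andP[/andP[h1 o1] all_ds] _.
have tr := even_traceable_gen_hypercube all_ds.
have := even_traceable_hypercube_factor h1 o1.
by move/even_traceable_cartesian_product/(_ tr) => [].
Qed.
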